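(* Let $q$ be a prime power, $n\ge 2$, $m=n-1$, and for $i=1,2$ let $C_i\le\mathbb{F}_q^{n\times(n-1)}$ be an $\mathbb{F}_q$-linear MRD code of $\mathbb{F}_q$-dimension $k_i$ and minimum rank distance $d_i$, and let $\mathcal{M}_i=\mathcal{M}[C_i]$. Assume $1<k_1<k_2$ and $k_1+k_2\ge n$. Let $\lambda=\frac{a}{b}$ with $a,b\in\mathbb{N}$, $\gcd(a,b)=1$, $0<\lambda<1$, and let $\mathcal{M}=(1-\lambda)\mathcal{M}_1+\lambda\mathcal{M}_2$. Then $\mu=b(n-1)$ is a denominator for $\mathcal{M}$ and $\mathcal{I}_\mu(\mathcal{M})=\mathcal{L}(E)$, where $E=\mathbb{F}_q^n$.
   Context: An $\mathbb{F}_q$-linear rank-metric code $C\le\mathbb{F}_q^{n\times m}$ is an $\mathbb{F}_q$-subspace; its minimum distance is $d=\min\{\mathrm{rk}(M):0\ne M\in C\}$; it is MRD if $\dim_{\mathbb{F}_q}C=\max\{n,m\}(\min\{n,m\}-d+1)$. For $U\le\mathbb{F}_q^n$ let $C(U)=\{M\in C:\mathrm{colsp}(M)\le U^\perp\}$ ($U^\perp$ the orthogonal complement w.r.t. the standard dot product), and define $\rho(U)=(\dim_{\mathbb{F}_q}C-\dim_{\mathbb{F}_q}C(U))/m$; then $\mathcal{M}[C]=(\mathcal{L}(\mathbb{F}_q^n),\rho)$ is a $q$-polymatroid. (For an MRD code in $\mathbb{F}_q^{n\times(n-1)}$ of dimension $k$, one has $\rho(U)=\dim U$ if $\dim U\le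 k/n$ and $\rho(U)=k/(n-1)$ if $\dim U>k/n$.) $(1-\lambda)\mathcal{M}_1+\lambda\mathcal{M}_2$ has rank function $(1-\lambda)\rho_1+\lambda\rho_2$. A denominator is $\mu>0$ with $\mu\rho(X)\in\mathbb{Z}_{\ge0}$ for all $X$; a space $I$ is $\mu$-independent if $\rho(J)\ge\dim(J)/\mu$ for all $J\le I$, and $\mathcal{I}_\mu(\mathcal{M})$ is the set of $\mu$-independent spaces. *)

(* Defs.v *)
From HB Require Import structures.
From mathcomp Require Import all_boot all_order all_algebra.
From mathcomp Require Import classical_sets.

Set Implicit Arguments.
Unset Strict Implicit.
Unset Printing Implicit Defensive.

Import Order.TTheory GRing.Theory Num.Theory.
Local Open Scope ring_scope.
Local Open Scope classical_set_scope.

Record qPolymatroid (F : fieldType) (E : vectType F) := QPolymatroid {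
  qrank : {vspace E} -> rat;
  qrank_bound : forall U, 0 <= qrank U <= (\dim U)%:R;
  qrank_mono : forall U V, (U <= V)%VS -> qrank U <= qrank V;
  qrank_submod : forall U V,
    qrank (U + V)%VS + qrank (U :&: V)%VS <= qrank U + qrank V
}.

Definition denominator (F : fieldType) (E : vectType F)
    (M : qPolymatroid E) (mu : rat) : Prop :=
  0 < mu /\ forall X : {vspace E}, mu * qrank M X \is a Num.nat.

Definition mu_independent (F : fieldType) (E : vectType F)
    (M : qPolymatroid E) (mu : rat) (I : {vspace E}) : Prop :=
  forall J : {vspace E}, (J <= I)%VS -> (\dim J)%:R / mu <= qrank M J.

Definition independent_spaces (F : fieldType) (E : vectType F)
    (M : qPolymatroid E) (mu : rat) : set {vspace E} :=
  [set I | mu_independent M mu I].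

Definition subspace_lattice (F : fieldType) (E : vectType F) :
    set {vspace E} := [set: {vspace E}].
Arguments subspace_lattice {F} E _.

Section ConvexCombination.
Variables (F : fieldType) (E : vectType F) (l : rat).
Hypothesis l01 : 0 <= l <= 1.
Variables M1 M2 : qPolymatroid E.

Definition conv_rank (U : {vspace E}) : rat :=
  (1 - l) * qrank M1 U + l * qrank M2 U.

Let l0 : 0 <= l. Proof. by case/andP: l01. Qed.
Let l1 : 0 <= 1 - l. Proof. by rewrite subr_ge0; case/andP: l01. Qed.

Fact conv_rank_bound U : 0 <= conv_rank U <= (\dim U)%:R.
Proof.
have /andP[a0 a1] := qrank_bound M1 U; have /andP[b0 b1] := qrank_bound M2 U.
apply/andP; split; first by rewrite addr_ge0 ?mulr_ge0.
have -> : (\dim U)%:R = (1 - l) * (\dim U)%:R + l * (\dim U)%:R.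
  by rewrite -mulrDl subrK mul1r.
by rewrite lerD ?ler_wpM2l.
Qed.

Fact conv_rank_mono U V : (U <= V)%VS -> conv_rank U <= conv_rank V.
Proof. by move=> UV; rewrite lerD ?ler_wpM2l ?qrank_mono. Qed.

Fact conv_rank_submod U V :
  conv_rank (U + V)%VS + conv_rank (U :&: V)%VS <= conv_rank U + conv_rank V.
Proof.
rewrite /conv_rank [leLHS]addrACA [leRHS]addrACA -!mulrDr.
by rewrite lerD ?ler_wpM2l ?qrank_submod.
Qed.

Definition qpm_conv : qPolymatroid E :=
  QPolymatroid conv_rank_bound conv_rank_mono conv_rank_submod.

End ConvexCombination.

Section RankMetricCodes.
Variables (F : finFieldType) (n m : nat).
Implicit Types (C : {vspace 'M[F]_(n, m)}) (U V : {vspace 'cV[F]_n}).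

Definition min_distance C (d : nat) : Prop :=
  (exists M, [/\ M \in C, M != 0 & \rank M = d]) /\
  (forall M, M \in C -> M != 0 -> (d <= \rank M)%N).

Definition MRD C : Prop :=
  exists2 d, min_distance C d & \dim C = (maxn n m * (minn n m - d + 1))%N.

Definition colsp (M : 'M[F]_(n, m)) : {vspace 'cV[F]_n} :=
  <<[seq col j M | j <- enum 'I_m]>>%VS.

(* Since F is finite, the orthogonal complement and the shortened code are    *)
(* given as spans of explicit lists; mem_orthv and mem_shorten show that the  *)
(* lists already are the subspaces.                                           *)
Definition orthv U : {vspace 'cV[F]_n} :=
  <<[seq v <- enum 'cV[F]_n |
      [forall u : 'cV[F]_n, (u \in U) ==> (u^T *m v == 0%R)]]>>%VS.

Definition shorten C U : {vspace 'M[F]_(n, m)} :=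
  <<[seq M <- enum 'M[F]_(n, m) | (M \in C) && (colsp M <= orthv U)%VS]>>%VS.

Definition code_rank C U : rat := ((\dim C)%:R - (\dim (shorten C U))%:R) / m%:R.

Lemma mem_span_filter (p r : nat) (P : pred 'M[F]_(p, r)) :
  P 0 -> (forall a u v, P u -> P v -> P (a *: u + v)) ->
  forall v, (v \in <<[seq v <- enum 'M[F]_(p, r) | P v]>>%VS) = P v.
Proof.
move=> P0 PD v; apply/idP/idP => [|Pv]; last first.
  by apply: memv_span; rewrite mem_filter Pv mem_enum.
set X := (X in <<X>>%VS) => vX; rewrite (coord_span (X := in_tuple X) vX).
elim/big_ind: _ => // [x y Px Py|i _]; first by rewrite -[x]scale1r PD.
rewrite -[_ *: _]addr0 PD //.
by have /= := mem_nth 0 (ltn_ord i); rewrite mem_filter => /andP[].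
Qed.

Lemma mem_orthv U v :
  reflect (forall u, u \in U -> u^T *m v = 0) (v \in orthv U).
Proof.
rewrite mem_span_filter.
- by apply: (iffP 'forall_implyP) => h u /h /eqP.
- by apply/'forall_implyP => u _; rewrite mulmx0.
move=> a x y /'forall_implyP hx /'forall_implyP hy.
apply/'forall_implyP => u uU.
by rewrite mulmxDr -scalemxAr (eqP (hx u uU)) (eqP (hy u uU)) scaler0 addr0.
Qed.

Lemma colsp_orthv M U :
  reflect (forall u, u \in U -> u^T *m M = 0) (colsp M <= orthv U)%VS.
Proof.
apply: (iffP span_subvP) => h.
- move=> u uU; apply/matrixP => i j.
  have /mem_orthv/(_ u uU) : col j M \in orthv U.
    by apply: h; apply: map_f; rewrite mem_enum.
  by rewrite colE mulmxA -colE => /matrixP/(_ i 0); rewrite mxE => ->; rewrite !mxE.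
- move=> _ /mapP[j _ ->]; apply/mem_orthv => u /h uM.
  by rewrite colE mulmxA uM mul0mx.
Qed.

Lemma mem_shorten C U M :
  (M \in shorten C U) = (M \in C) && (colsp M <= orthv U)%VS.
Proof.
rewrite mem_span_filter //.
  by rewrite mem0v; apply/colsp_orthv => u _; rewrite mulmx0.
move=> a x y /andP[xC /colsp_orthv hx] /andP[yC /colsp_orthv hy].
rewrite memvD ?memvZ //=; apply/colsp_orthv => u uU.
by rewrite mulmxDr -scalemxAr hx // hy // scaler0 addr0.
Qed.

Lemma shortenP C U M :
  reflect (M \in C /\ forall u, u \in U -> u^T *m M = 0) (M \in shorten C U).
Proof.
by rewrite mem_shorten; apply: (iffP andP) => -[h /colsp_orthv].
Qed.

Lemma shorten_sub C U : (shorten C U <= C)%VS.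
Proof. by apply/subvP => M /shortenP[]. Qed.

Lemma shortenS C U V : (U <= V)%VS -> (shorten C V <= shorten C U)%VS.
Proof.
move=> /subvP UV; apply/subvP => M /shortenP[MC h].
by apply/shortenP; split=> // u /UV /h.
Qed.

Lemma dim_shorten C U : (\dim C <= \dim (shorten C U) + \dim U * m)%N.
Proof.
pose B : 'M[F]_(\dim U, n) := \matrix_(i, j) (vbasis U)`_i j 0.
pose f : 'Hom('M[F]_(n, m), 'M[F]_(\dim U, m)) := linfun (mulmx B).
rewrite -(limg_ker_dim f C) leq_add //.
  apply: dimvS; apply/subvP => M; rewrite memv_cap memv_ker lfunE /=.
  move=> /andP[MC /eqP BM]; apply/shortenP; split=> // u /coord_vbasis ->.
  have -> : (\sum_(i < \dim U) coord (vbasis U) i u *: (vbasis U)`_i)^T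
     = (\row_i coord (vbasis U) i u) *m B.
    apply/matrixP => i j; rewrite !ord1 !mxE summxE.
    by apply: eq_bigr => k _; rewrite !mxE.
  by rewrite -mulmxA BM mulmx0.
by rewrite (leq_trans (dimvS (subvf _))) // dimvf.
Qed.

Fact code_rank_bound C U : 0 <= code_rank C U <= (\dim U)%:R.
Proof.
apply/andP; split; rewrite /code_rank.
  by rewrite divr_ge0 // subr_ge0 ler_nat dimvS ?shorten_sub.
have [m0|m0] := posnP m.
  by have -> : m%:R = 0 :> rat by [rewrite m0]; rewrite invr0 mulr0.
by rewrite ler_pdivrMr ?ltr0n // lerBlDl -natrM -natrD ler_nat dim_shorten.
Qed.

Fact code_rank_mono C U V : (U <= V)%VS -> code_rank C U <= code_rank C V.
Proof.
by move=> UV; rewrite ler_wpM2r ?invr_ge0 // lerB // ler_nat dimvS ?shortenS.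
Qed.

Fact code_rank_submod C U V :
  code_rank C (U + V)%VS + code_rank C (U :&: V)%VS
    <= code_rank C U + code_rank C V.
Proof.
rewrite -!mulrDl ler_wpM2r ?invr_ge0 // [leLHS]addrACA [leRHS]addrACA lerD2l.
rewrite -!opprD lerN2 -!natrD ler_nat -dimv_sum_cap addnC leq_add //; last first.
  by apply: dimvS; rewrite subv_add !shortenS ?capvSl ?capvSr.
apply: dimvS; apply/subvP => M; rewrite memv_cap.
move=> /andP[/shortenP[MC hU] /shortenP[_ hV]].
apply/shortenP; split=> // _ /memv_addP[u uU [v vV ->]].
by rewrite linearD mulmxDl hU // hV // addr0.
Qed.

Definition qpm_code C : qPolymatroid 'cV[F]_n :=
  QPolymatroid (code_rank_bound C) (@code_rank_mono C) (code_rank_submod C).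

End RankMetricCodes.

Fact lt01W (l : rat) : 0 < l < 1 -> 0 <= l <= 1.
Proof. by case/andP => /ltW -> /ltW ->. Qed.

(* Main.v *)
(* Clearing denominators, the claim reduces to dim C - dim C(J) >= dim J for an *)
(* MRD code C in F^(n x (n-1)). Enlarge J by a space W so that                  *)
(* dim (J + W) > n - d; then C(J + W) = 0, since its matrices have rank < d, so *)
(* dim C(J) <= (n - 1) dim W by dim_shorten applied to the code C(J). With      *)
(* dim C = n (n - d) this gives the claim.                                      *)
From mathcomp Require Import all_boot all_order all_algebra.
From mathcomp Require Import classical_sets zify ring.
Require Import Defs.

Import Order.TTheory GRing.Theory Num.Theory.
Local Open Scope ring_scope.

(** Scaling by b(n-1) turns the rank of X into (b-a)(dim C1 - dim C1(X)) + a(dim C2 - dim C2(X)), a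
    natural number; as b-a >= 1, its first term already dominates dim X by [MRD_dim_shorten]. That
    lemma compares dim C = n(n-d) with the bound of [dim_shorten_leq], whose vanishing of C(J+W)
    rests on [rank_annihilated]. *)

(** Stack a basis of U as the rows of [B]: it has rank dim U and B M = 0. *)
Lemma rank_annihilated (F : finFieldType) (n m : nat) (U : {vspace 'cV[F]_n})
    (M : 'M[F]_(n, m)) :
  (forall u, u \in U -> u^T *m M = 0) -> (\dim U + \rank M <= n)%N.
Proof.
move=> UM; pose B : 'M[F]_(\dim U, n) := \matrix_(i, j) (vbasis U)`_i j 0.
have BM : B *m M = 0.
  apply/row_matrixP => i; rewrite row_mul row0.
  have -> : row i B = ((vbasis U)`_i)^T by apply/rowP => j; rewrite !mxE.
  by apply/UM/vbasis_mem/mem_nth; rewrite size_tuple.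
have -> : \dim U = \rank B; last exact: mulmx0_rank_max.
apply/esym/eqP/inj_row_free => v vB.
apply/rowP => i; rewrite mxE.
have /freeP := basis_free (vbasisP U); apply.
apply/colP => j; rewrite mxE summxE.
have /rowP/(_ j) := vB; rewrite !mxE => vBj; rewrite -[RHS]vBj.
by apply: eq_bigr => k _; rewrite !mxE.
Qed.

Lemma exists_subv_dim (K : fieldType) (E : vectType K) (V : {vspace E}) (r : nat) :
  (r <= \dim V)%N -> exists2 W : {vspace E}, (W <= V)%VS & \dim W = r.
Proof.
move=> rV; exists <<take r (vbasis V)>>%VS.
  by apply/span_subvP => x /mem_take /vbasis_mem.
have : free (take r (vbasis V)).
  by have := basis_free (vbasisP V); rewrite -{1}(cat_take_drop r (vbasis V));
    apply: catl_free.
by move/eqnP ->; rewrite size_takel ?size_tuple.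
Qed.

Lemma dim_shorten_leq (F : finFieldType) (n m d : nat)
    (C : {vspace 'M[F]_(n, m)}) (U : {vspace 'cV[F]_n}) :
  (0 < d)%N -> (forall M, M \in C -> M != 0 -> (d <= \rank M)%N) ->
  (\dim (shorten C U) <= (n.+1 - d - \dim U) * m)%N.
Proof.
move=> d_gt0 minC.
have dimUC : (\dim U + \dim U^C)%N = n.
  rewrite -dimv_disjoint_sum ?capv_compl //.
  by rewrite addv_complf dimvf /dim /= muln1.
(* The complement is large enough because d > 0. Truncated subtraction gives W = 0 when dim U > n -
   d already. *)
have [|W WUC dimW] := @exists_subv_dim _ _ U^C%VS (n.+1 - d - \dim U); first lia.
have dimUW : \dim (U + W) = (\dim U + \dim W)%N.
  apply/dimv_disjoint_sum/eqP; rewrite -subv0 -(capv_compl U).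
  exact: capvS.
have := dim_shorten (shorten C U) W; rewrite dimW.
suff -> : shorten (shorten C U) W = 0%VS by rewrite dimv0.
apply/eqP; rewrite -subv0; apply/subvP => M /shortenP[/shortenP[MC MU] MW].
rewrite memv0; apply: contraT => /(minC _ MC) dM.
suff : (\dim (U + W) + \rank M <= n)%N by lia.
apply: rank_annihilated => _ /memv_addP[u uU [w wW ->]].
by rewrite linearD mulmxDl MU // MW // addr0.
Qed.

Lemma MRD_dim_shorten (F : finFieldType) (n : nat)
    (C : {vspace 'M[F]_(n, n.-1)}) (U : {vspace 'cV[F]_n}) :
  MRD C -> (\dim (shorten C U) + \dim U <= \dim C)%N.
Proof.
case=> d [[M [_ Mn0 rkM]] minC] dimC.
have d_gt0 : (0 < d)%N by rewrite -rkM lt0n mxrank_eq0.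
have d_le : (d <= n.-1)%N by rewrite -rkM rank_leq_col.
(* For U = 0 the bound of [dim_shorten_leq] exceeds dim C by d - 1, so this case is treated
   apart. *)
have [->|U_gt0] := posnP (\dim U); first by rewrite addn0 dimvS ?shorten_sub.
have U_le : (\dim U <= n)%N.
  by rewrite (leq_trans (dimvS (subvf _))) // dimvf /dim /= muln1.
have := dim_shorten_leq _ _ _ _ _ U d_gt0 minC.
(* Here max(n, n-1) = n and (n-1) - d + 1 = n - d, which is positive. *)
have -> : \dim C = (n * (n - d))%N by rewrite dimC; congr (_ * _)%N; lia.
have [|U_lt] := leqP (n.+1 - d) (\dim U); last nia.
(* Now C(U) = 0, and dim U <= n <= n(n-d). *)
by rewrite -subn_eq0 => /eqP ->; nia.
Qed.

Theorem theorem8p8 (F : finFieldType) (n : nat) (n_ge2 : (2 <= n)%N)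
    (C1 C2 : {vspace 'M[F]_(n, n.-1)}) (k1 k2 d1 d2 : nat)
    (C1_MRD : MRD C1) (C2_MRD : MRD C2)
    (dimC1 : \dim C1 = k1) (dimC2 : \dim C2 = k2)
    (distC1 : min_distance C1 d1) (distC2 : min_distance C2 d2)
    (k1_gt1 : (1 < k1)%N) (k1_lt_k2 : (k1 < k2)%N) (k12_ge : (n <= k1 + k2)%N)
    (a b : nat) (coprime_ab : coprime a b)
    (lambda : rat) (lambdaE : lambda = a%:R / b%:R)
    (lambda01 : 0 < lambda < 1) :
  let M := qpm_conv (lt01W lambda01) (qpm_code C1) (qpm_code C2) in
  let mu : rat := (b * n.-1)%:R in
  denominator M mu /\
  independent_spaces M mu = subspace_lattice 'cV[F]_n.
Proof.
move=> M mu; have /andP[lambda_gt0 lambda_lt1] := lambda01.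
have b_gt0 : (0 < b)%N.
  case: posnP => // b0; move: lambda_gt0.
  by rewrite lambdaE b0 invr0 mulr0 ltxx.
have bR_gt0 : 0 < b%:R :> rat by rewrite ltr0n.
have a_lt_b : (a < b)%N.
  by move: lambda_lt1; rewrite lambdaE ltr_pdivrMr // mul1r ltr_nat.
have m_gt0 : (0 < n.-1)%N by lia.
have mu_gt0 : 0 < mu by rewrite ltr0n muln_gt0 b_gt0.
have rankE X : mu * qrank M X = ((b - a) * (\dim C1 - \dim (shorten C1 X))
                                + a * (\dim C2 - \dim (shorten C2 X)))%:R.
  (* No subtraction truncates: C_i(X) lies in C_i and a < b. *)
  rewrite natrD !natrM !natrB ?dimvS ?shorten_sub ?(ltnW a_lt_b) //.
  rewrite /mu natrM /= /conv_rank /= /code_rank lambdaE.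
  by field; rewrite !pnatr_eq0 -!lt0n b_gt0 m_gt0.
split; first by split=> // X; rewrite rankE natr_nat.
apply/seteqP; split=> // I _ J _.
rewrite ler_pdivrMr // mulrC rankE ler_nat.
rewrite (@leq_trans ((b - a) * (\dim C1 - \dim (shorten C1 J)))%N) ?leq_addr //.
apply: leq_trans (leq_pmull _ _); last by rewrite subn_gt0.
have := MRD_dim_shorten _ _ _ J C1_MRD; lia.
Qed.
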